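(* For all $\varepsilon>0$, there exists a noninteractive $\varepsilon$-LEDP algorithm based on Randomized Response that gets an $n$-node graph $G$ as input and returns an unbiased estimate $\hat{T}$ of the number of triangles in $G$ that has variance $\Theta\Big(\frac{C_4(G)}{\varepsilon^2}+\frac{n^{3}}{\varepsilon^6}\Big)$, where $C_4(G)$ is the number of 4-cycles in $G$. In particular, with high constant probability, $\hat{T}$ has additive error $O\Big(\frac{\sqrt{C_4(G)}}{\varepsilon}+\frac{n^{3/2}}{\varepsilon^3}\Big)$.
   Context: Local edge model: the input is an undirected graph $G=([n],E)$; node $i$ holds its row $\mathbf{a}_{i*}\in\{0,1\}^n$ of the adjacency matrix. An $\varepsilon$-local randomizer is a randomized map $R:\{0,1\}^n\to\mathcal{Y}$ with $\Pr[R(\mathbf{a})\in Y]\le e^{\varepsilon}\Pr[R(\mathbf{a}')\in Y]$ for all $\mathbf{a},\mathbf{a}'$ differing in one bit and all $Y$. An algorithm is $\varepsilon$-LEDP if the entire transcript of its interaction with the parties is $\varepsilon$-differentially private with respect to graphs differing in one edge. A noninteractive LEDP algorithm is specified by one local randomizer per node, applied once to that node's adjacency vector, followed by postprocessing of the randomizers' outputs. Randomized Response with parameter $\varepsilon$ on a bit vector outputs each bit unchanged with probability $\frac{e^\varepsilon}{e^\varepsilon+1}$ and flipped otherwise, independently. *)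

(* Defs.v *)
From HB Require Import structures.
From mathcomp Require Import all_boot all_order all_algebra.
From mathcomp Require Import reals sequences exp.

Set Implicit Arguments.
Unset Strict Implicit.
Unset Printing Implicit Defensive.

Import Order.TTheory GRing.Theory Num.Theory.

Local Open Scope ring_scope.

Record fdist (R : realType) (T : finType) := Fdist {
  pmf :> T -> R;
  pmf_ge0 : forall x, 0 <= pmf x;
  pmf_sum1 : \sum_x pmf x = 1 }.

Definition Pr (R : realType) (T : finType) (d : fdist R T) (A : pred T) : R :=
  \sum_(x | A x) d x.

Definition Expect (R : realType) (T : finType) (d : fdist R T) (X : T -> R) : R :=
  \sum_x d x * X x.

Definition Variance (R : realType) (T : finType) (d : fdist R T) (X : T -> R) : R :=
  Expect d (fun x => (X x - Expect d X) ^+ 2).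

Section Products.
Variable R : realType.

Section Family.
Variables (I T : finType) (d : I -> fdist R T).

Definition prod_pmf (t : {ffun I -> T}) : R := \prod_i d i (t i).

Lemma prod_pmf_ge0 t : 0 <= prod_pmf t.
Proof. by apply: prodr_ge0 => i _; exact: pmf_ge0. Qed.

Lemma prod_pmf_sum1 : \sum_t prod_pmf t = 1.
Proof.
rewrite -(bigA_distr_bigA (fun i x => d i x)).
by apply: big1 => i _; exact: pmf_sum1.
Qed.

(* Joint law of independent variables with laws [d i]. *)
Definition fdist_family : fdist R {ffun I -> T} := Fdist prod_pmf_ge0 prod_pmf_sum1.

End Family.

Section Pair.
Variables (S T : finType) (d : fdist R S) (e : fdist R T).

Definition pair_pmf (p : S * T) : R := d p.1 * e p.2.

Lemma pair_pmf_ge0 p : 0 <= pair_pmf p.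
Proof. by apply: mulr_ge0; exact: pmf_ge0. Qed.

Lemma pair_pmf_sum1 : \sum_p pair_pmf p = 1.
Proof.
rewrite -(pair_bigA _ (fun x y => d x * e y)) /= -(pmf_sum1 d).
by apply: eq_bigr => x _; rewrite -mulr_sumr pmf_sum1 mulr1.
Qed.

Definition fdist_pair : fdist R (S * T)%type := Fdist pair_pmf_ge0 pair_pmf_sum1.

End Pair.

End Products.

Section RandomizedResponse.
Variables (R : realType) (eps : R).

Definition rr_keep : R := expR eps / (expR eps + 1).

Definition bit_pmf (b c : bool) : R := if c == b then rr_keep else 1 - rr_keep.

Lemma bit_pmf_ge0 b c : 0 <= bit_pmf b c.
Proof.
rewrite /bit_pmf; have e0 : 0 < expR eps by exact: expR_gt0.
have e1 : 0 < expR eps + 1 by rewrite addr_gt0.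
case: ifP => _; first by rewrite /rr_keep divr_ge0 // ltW.
by rewrite subr_ge0 /rr_keep ler_pdivrMr // mul1r lerDl.
Qed.

Lemma bit_pmf_sum1 b : \sum_c bit_pmf b c = 1.
Proof.
rewrite big_bool /bit_pmf; case: b => /=; first by rewrite addrC subrK.
by rewrite subrK.
Qed.

Definition rr_bit (b : bool) : fdist R bool :=
  Fdist (bit_pmf_ge0 b) (bit_pmf_sum1 b).

Definition rr (I : finType) (x : {ffun I -> bool}) : fdist R {ffun I -> bool} :=
  fdist_family (fun j => rr_bit (x j)).

End RandomizedResponse.

Record sgraph (n : nat) := SGraph {
  adj : rel 'I_n;
  adj_sym : symmetric adj;
  adj_irr : irreflexive adj }.

Section Graphs.
Variables (n : nat) (G : sgraph n).

Definition adj_row (i : 'I_n) : {ffun 'I_n -> bool} := [ffun j => adj G i j].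

Definition edges : {set {set 'I_n}} :=
  [set [set p.1; p.2] | p : 'I_n * 'I_n & adj G p.1 p.2].

Definition triangles : {set {set 'I_n}} :=
  [set S : {set 'I_n} | (#|S| == 3)%N &&
     [forall x in S, forall y in S, (x != y) ==> adj G x y]].

(* A 4-cycle is a (not necessarily induced) subgraph, identified with its edge
   set, so that each one is counted once and not once per labelling. *)
Definition four_cycles : {set {set {set 'I_n}}} :=
  [set F : {set {set 'I_n}} |
     [exists a, exists b, exists c, exists d,
       [&& uniq [:: a; b; c; d],
           adj G a b, adj G b c, adj G c d, adj G d a &
           F == [set [set a; b]; [set b; c]; [set c; d]; [set d; a]]]]].

End Graphs.

Definition edge_neighbors (n : nat) (G H : sgraph n) : Prop :=
  #|(edges G :\: edges H) :|: (edges H :\: edges G)| = 1%N.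

Definition local_randomizer (R : realType) (eps : R) (n : nat) (Y : finType)
    (rand : {ffun 'I_n -> bool} -> fdist R Y) : Prop :=
  forall a a' : {ffun 'I_n -> bool}, #|[set j | a j != a' j]| = 1%N ->
  forall Z : pred Y, Pr (rand a) Z <= expR eps * Pr (rand a') Z.

(* Node [i] applies [randomizer i] once, to its own adjacency row, with
   independent coins.  The postprocessing [postprocess] may be randomized: its
   coins are drawn from [seed_law], independently of the transcript. *)
Record noninteractive_alg (R : realType) (n : nat) := NonInteractive {
  output : finType;
  randomizer : 'I_n -> {ffun 'I_n -> bool} -> fdist R output;
  seed : finType;
  seed_law : fdist R seed;
  postprocess : {ffun 'I_n -> output} -> seed -> R }.

Section Algorithms.
Variables (R : realType) (n : nat) (A : noninteractive_alg R n).

Definition transcript_law (G : sgraph n) : fdist R {ffun 'I_n -> output A} :=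
  fdist_family (fun i => randomizer A i (adj_row G i)).

Definition run_law (G : sgraph n) :
    fdist R ({ffun 'I_n -> output A} * seed A)%type :=
  fdist_pair (transcript_law G) (seed_law A).

Definition estimate (w : {ffun 'I_n -> output A} * seed A) : R :=
  postprocess w.1 w.2.

Definition ledp (eps : R) : Prop :=
  (forall i, local_randomizer eps (randomizer A i)) /\
  (forall G H : sgraph n, edge_neighbors G H ->
   forall Z : pred {ffun 'I_n -> output A},
     Pr (transcript_law G) Z <= expR eps * Pr (transcript_law H) Z).

End Algorithms.

Definition mask (n : nat) (S : {set 'I_n}) (a : {ffun 'I_n -> bool}) :
    {ffun 'I_n -> bool} := [ffun j => (j \in S) && a j].

(* Node [i] is responsible for reporting the bits indexed by [S i] and replaces
   the other ones by 0 before applying Randomized Response.  Without masking,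
   every edge would be reported by both endpoints, and Randomized Response with
   parameter [eps] would only give a [2 eps]-private transcript. *)
Definition rr_alg (R : realType) (eps : R) (n : nat) (S : 'I_n -> {set 'I_n})
    (W : finType) (w : fdist R W)
    (post : {ffun 'I_n -> {ffun 'I_n -> bool}} -> W -> R) :
    noninteractive_alg R n :=
  NonInteractive (fun i a => rr eps (mask (S i) a)) w post.

Definition based_on_rr (R : realType) (eps : R) (n : nat)
    (A : noninteractive_alg R n) : Prop :=
  exists (S : 'I_n -> {set 'I_n}) (W : finType) (w : fdist R W)
         (post : {ffun 'I_n -> {ffun 'I_n -> bool}} -> W -> R),
    A = rr_alg eps S w post.

Definition variance_rate (R : realType) (eps : R) (n : nat) (G : sgraph n) : R :=
  #|four_cycles G|%:R / eps ^+ 2 + n%:R ^+ 3 / eps ^+ 6.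

Definition error_rate (R : realType) (eps : R) (n : nat) (G : sgraph n) : R :=
  Num.sqrt #|four_cycles G|%:R / eps + n%:R `^ (3 / 2) / eps ^+ 3.

(* Main.v *)
(* Every pair of nodes is reported once, so debiasing the reports gives a
   symmetric matrix M with zero diagonal, independent entries above it and mean
   the adjacency matrix; hence tr(M^3)/6 is unbiased for the number of triangles.
   It is affine in each entry M_ij, with slope (M^2)_ij, the noisy codegree P_ij,
   and P_ij is again affine in the entries.  The Efron-Stein inequality, applied
   twice, therefore gives the upper bounds, in terms of s = e^eps/(e^eps - 1)^2,
   the variance of one debiased bit.

   The variance of this estimator is exponentially small for large eps, so the
   lower bound needs extra noise: add a random sign times the square root of
     sum_(i <> j) max(0, P_ij - 1)^2 / eps^2 + n^3 / eps^6,
   which leaves the mean unchanged and adds the mean of this quantity to the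
   variance.  By Jensen's inequality that mean is at least the value at the true
   codegrees d_ij, and max(0, d - 1)^2 is comparable to d(d - 1), whose sum over
   ordered pairs counts the rooted 4-cycles.  All upper bounds then follow from
   s = O(eps^-2k) for k = 1, 2, 3. *)

Require Import Defs.
From HB Require Import structures.
From mathcomp Require Import all_boot all_order all_algebra.
From mathcomp Require Import reals sequences exp.
From mathcomp Require Import ring lra zify.

Set Implicit Arguments.
Unset Strict Implicit.
Unset Printing Implicit Defensive.

Import Order.TTheory GRing.Theory Num.Theory.

Local Open Scope ring_scope.

(** * Expectation and variance on finite spaces *)

Section ExpectTheory.
Variables (R : realType) (T : finType) (d : fdist R T).
Implicit Types X Y : T -> R.

Lemma eq_Expect X Y : X =1 Y -> Expect d X = Expect d Y.
Proof. by move=> e; apply: eq_bigr => x _; rewrite e. Qed.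

Lemma Expect_cst a : Expect d (fun=> a) = a.
Proof. by rewrite /Expect -mulr_suml pmf_sum1 mul1r. Qed.

Lemma ExpectD X Y : Expect d (fun x => X x + Y x) = Expect d X + Expect d Y.
Proof. by rewrite -big_split; apply: eq_bigr => x _; rewrite mulrDr. Qed.

Lemma ExpectZ a X : Expect d (fun x => a * X x) = a * Expect d X.
Proof. by rewrite /Expect mulr_sumr; apply: eq_bigr => x _; rewrite mulrCA. Qed.

Lemma Expect_sum (I : Type) (r : seq I) (P : pred I) (F : I -> T -> R) :
  Expect d (fun x => \sum_(i <- r | P i) F i x) =
  \sum_(i <- r | P i) Expect d (F i).
Proof.
rewrite exchange_big; apply: eq_bigr => x _; exact: mulr_sumr.
Qed.

Lemma le_Expect X Y : (forall x, X x <= Y x) -> Expect d X <= Expect d Y.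
Proof. by move=> le; apply: ler_sum => x _; rewrite ler_wpM2l ?pmf_ge0. Qed.

Lemma Expect_ge0 X : (forall x, 0 <= X x) -> 0 <= Expect d X.
Proof. by move=> le; rewrite sumr_ge0 // => x _; rewrite mulr_ge0 ?pmf_ge0. Qed.

Lemma Variance_ge0 X : 0 <= Variance d X.
Proof. by apply: Expect_ge0 => x; exact: sqr_ge0. Qed.

Lemma VarianceE X : Variance d X = Expect d (fun x => X x ^+ 2) - Expect d X ^+ 2.
Proof.
rewrite /Variance; set m := Expect d X.
rewrite (@eq_Expect _ (fun x => (X x ^+ 2 + (- (2 * m)) * X x) + m ^+ 2)); last first.
  by move=> x; ring.
by rewrite !ExpectD ExpectZ Expect_cst -/m; ring.
Qed.

Lemma Expect_sqr_le X : Expect d X ^+ 2 <= Expect d (fun x => X x ^+ 2).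
Proof. by rewrite -subr_ge0 -VarianceE Variance_ge0. Qed.

Lemma Variance_affine (X Y : T -> R) a b :
  (forall x, Y x = a + X x * b) -> Variance d Y = b ^+ 2 * Variance d X.
Proof.
move=> e; have mE : Expect d Y = a + b * Expect d X.
  rewrite (eq_Expect e) ExpectD Expect_cst; congr (_ + _).
  by rewrite -ExpectZ; apply: eq_Expect => x; rewrite mulrC.
rewrite /Variance mE -[RHS]ExpectZ; apply: eq_Expect => x; rewrite e; ring.
Qed.

(* The inequality inside [Pr] is not strict, which makes [s = 0] a valid case. *)
Lemma chebyshev X (K s delta : R) : 0 <= K -> 0 <= s -> 0 < delta ->
  Variance d X <= delta * K ^+ 2 * s ^+ 2 ->
  1 - delta <= Pr d (fun x => `|X x - Expect d X| <= K * s).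
Proof.
move=> K0 s0 d0 V; set m := Expect d X; set A := fun x => _ <= _.
have bE : 1 = Pr d A + \sum_(x | ~~ A x) d x.
  by rewrite -(pmf_sum1 d) (bigID A).
rewrite {1}bE lerBlDr lerD2l.
have t0 : 0 <= (K * s) ^+ 2 by exact: sqr_ge0.
have dev x : ~~ A x -> (K * s) ^+ 2 < (X x - m) ^+ 2.
  rewrite /A -ltNge => lt; rewrite -[ltRHS]real_normK ?num_real //.
  by rewrite ltr_pXn2r // nnegrE ?mulr_ge0.
have sub (F : T -> R) : (forall x, 0 <= F x) ->
    \sum_(x | ~~ A x) F x <= \sum_x F x.
  by move=> F0; rewrite [leRHS](bigID A) /= lerDr sumr_ge0.
have V' : \sum_(x | ~~ A x) d x * (X x - m) ^+ 2 <= delta * (K * s) ^+ 2.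
  rewrite exprMn mulrA; apply: le_trans V.
  by apply: sub => x; rewrite mulr_ge0 ?pmf_ge0 ?sqr_ge0.
(* If [K * s = 0], the variance bound is 0, so each point outside [A], having a positive deviation,
   has mass 0. Otherwise Markov's inequality for the squared deviation applies after dividing by
   [(K * s) ^+ 2]. *)
case: (eqVneq ((K * s) ^+ 2) 0) V' => [z|nz] V'.
  rewrite big1 ?ltW // => x Ax; apply/eqP; rewrite eq_le pmf_ge0 andbT.
  rewrite -(@ler_pM2r _ ((X x - m) ^+ 2)); last first.
    by rewrite -z; exact: dev.
  rewrite mul0r; apply: le_trans (_ : delta * (K * s) ^+ 2 <= 0); last first.
    by rewrite z mulr0.
  apply: le_trans V'; rewrite (bigD1 x) //= lerDl sumr_ge0 // => y _.
  by rewrite mulr_ge0 ?pmf_ge0 ?sqr_ge0.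
rewrite -(@ler_pM2r _ ((K * s) ^+ 2)) ?lt_def ?nz //.
apply: le_trans V'; rewrite mulr_suml; apply: ler_sum => x Ax.
by rewrite ler_wpM2l ?pmf_ge0 // ltW // dev.
Qed.

End ExpectTheory.

Lemma exchange_Expect (R : realType) (S T : finType) (d : fdist R S)
    (e : fdist R T) (F : S -> T -> R) :
  Expect d (fun x => Expect e (F x)) = Expect e (fun y => Expect d (F^~ y)).
Proof.
rewrite /Expect; under eq_bigr do rewrite mulr_sumr.
rewrite exchange_big; apply: eq_bigr => y _; rewrite mulr_sumr.
by apply: eq_bigr => x _; rewrite mulrCA.
Qed.

Lemma Expect_pair (R : realType) (S T : finType) (d : fdist R S)
    (e : fdist R T) (F : S * T -> R) :
  Expect (fdist_pair d e) F = Expect d (fun x => Expect e (fun y => F (x, y))).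
Proof.
rewrite /Expect (eq_bigr (fun p => d p.1 * (e p.2 * F (p.1, p.2)))).
  rewrite -(pair_bigA _ (fun x y => d x * (e y * F (x, y)))).
  by apply: eq_bigr => x _; rewrite mulr_sumr.
by case=> x y _; rewrite mulrA.
Qed.

(** * The Efron-Stein inequality *)

Section ProductLaws.
Variables (R : realType) (I T : finType) (d : I -> fdist R T).
Implicit Types (t : {ffun I -> T}) (F : {ffun I -> T} -> R).

Definition upd t i b : {ffun I -> T} := [ffun j => if j == i then b else t j].

Lemma upd_id t i : upd t i (t i) = t.
Proof. by apply/ffunP => j; rewrite ffunE; case: eqP => [->|]. Qed.

Lemma upd_upd t i b c : upd (upd t i b) i c = upd t i c.
Proof. by apply/ffunP => j; rewrite !ffunE; case: eqP. Qed.

Lemma updC t i j b c : i != j -> upd (upd t i b) j c = upd (upd t j c) i b.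
Proof.
move=> ij; apply/ffunP => k; rewrite !ffunE; case: (eqVneq k j) => // ->.
by rewrite eq_sym (negPf ij).
Qed.

Lemma Expect_prod (s : seq I) (f : I -> T -> R) : uniq s ->
  Expect (fdist_family d) (fun t => \prod_(i <- s) f i (t i)) =
  \prod_(i <- s) Expect (d i) (f i).
Proof.
(* The factor 1 outside [s] extends the products to all of [I], where distributivity exchanges
   product and sum. *)
move=> us; pose g i x := if i \in s then f i x else 1.
have sE (h : I -> R) : \prod_(i <- s) h i = \prod_i (if i \in s then h i else 1).
  by rewrite big_uniq //= big_mkcond.
have EgE i : (if i \in s then Expect (d i) (f i) else 1) = \sum_x d i x * g i x.
  rewrite /g; case: ifP => // _.
  by under eq_bigr do rewrite mulr1; rewrite pmf_sum1.
rewrite sE (eq_bigr _ (fun i _ => EgE i)) bigA_distr_bigA.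
by apply: eq_bigr => t _; rewrite sE -big_split.
Qed.

(** The conditional expectation of [F] given all coordinates but [i]. *)
Definition resample i F t : R := Expect (d i) (fun b => F (upd t i b)).

(** The tower property: exchanging coordinate [i] with an independent fresh copy is an involution
    that preserves the joint law. *)
Lemma Expect_resample i F :
  Expect (fdist_family d) (resample i F) = Expect (fdist_family d) F.
Proof.
pose swap (p : {ffun I -> T} * T) := (upd p.1 i p.2, p.1 i).
have swapK : involutive swap.
  by case=> t b; rewrite /swap /= ffunE eqxx upd_upd upd_id.
pose mu := fdist_pair (fdist_family d) (d i).
transitivity (Expect mu (fun p => F (swap p).1)); first by rewrite Expect_pair.
transitivity (Expect mu (fun p => F p.1)).
  rewrite /Expect (reindex_inj (inv_inj swapK)).
  apply: eq_bigr => -[t b] _; rewrite swapK; congr (_ * _).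
  rewrite /= /pair_pmf /= /prod_pmf (bigD1 i) //= [in RHS](bigD1 i) //= ffunE eqxx.
  rewrite (eq_bigr (fun j => d j (t j))); first by ring.
  by move=> j ji; rewrite ffunE (negPf ji).
by rewrite Expect_pair; apply: eq_Expect => t; exact: (Expect_cst (d i) (F t)).
Qed.

(** The conditional variance of [F] given all coordinates but [i]. *)
Definition cvar i F t : R := Variance (d i) (fun b => F (upd t i b)).

Lemma Expect_cvar i F : Expect (fdist_family d) (cvar i F) =
  Expect (fdist_family d) (fun t => F t ^+ 2) -
  Expect (fdist_family d) (fun t => resample i F t ^+ 2).
Proof.
rewrite -(Expect_resample i (fun t => F t ^+ 2)) -[X in _ - X]mul1r -mulNr.
rewrite -ExpectZ -ExpectD; apply: eq_Expect => t.
by rewrite /cvar VarianceE mulN1r.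
Qed.

(* Averaging is a convex operation, so it does not increase the variance. *)
Lemma cvar_resample i j F : i != j ->
  Expect (fdist_family d) (cvar j (resample i F)) <=
  Expect (fdist_family d) (cvar j F).
Proof.
move=> ij; rewrite -(Expect_resample i (cvar j F)); apply: le_Expect => t.
pose Y c b := F (upd (upd t i b) j c).
have YE c : resample i F (upd t j c) = Expect (d i) (Y c).
  by apply: eq_Expect => b; rewrite /Y (updC _ _ _ ij).
pose m b := Expect (d j) (Y^~ b).
have mE : Expect (d j) (fun c => resample i F (upd t j c)) = Expect (d i) m.
  by rewrite (eq_Expect _ YE) exchange_Expect.
have -> : resample i (cvar j F) t =
    Expect (d j) (fun c => Expect (d i) (fun b => (Y c b - m b) ^+ 2)).
  exact: exchange_Expect.
rewrite /cvar /Variance mE; apply: le_Expect => c; rewrite YE.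
have -> : Expect (d i) (Y c) - Expect (d i) m = Expect (d i) (fun b => Y c b - m b).
  rewrite -mulN1r -ExpectZ -ExpectD; apply: eq_Expect => b; by rewrite mulN1r.
exact: Expect_sqr_le.
Qed.

Fixpoint resamples (l : seq I) F := if l is i :: l' then resamples l' (resample i F) else F.

Lemma Expect_resamples l F :
  Expect (fdist_family d) (resamples l F) = Expect (fdist_family d) F.
Proof. by elim: l F => //= i l IH F; rewrite IH Expect_resample. Qed.

(** Averaging over a coordinate removes the dependence on it. The list [k] of coordinates already
    removed grows along the induction. *)
Lemma resamples_local l (k : seq I) F :
  (forall t t', (forall i, i \notin k -> t i = t' i) -> F t = F t') ->
  forall t t', (forall i, i \notin l ++ k -> t i = t' i) ->
  resamples l F t = resamples l F t'.
Proof.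
elim: l k F => [|i l IH] k F Fk t t' tt' /=; first exact: Fk.
apply: (IH (i :: k)) => [u u' uu'|j jlk]; last first.
  by apply: tt'; move: jlk; rewrite /= !(mem_cat, inE) orbCA.
apply: eq_Expect => b; apply: Fk => j jk; rewrite !ffunE; case: eqP => // /eqP ji.
by apply: uu'; rewrite inE negb_or ji.
Qed.

(** The left side telescopes: averaging out [i] lowers the second moment by exactly the mean of
    [cvar i], and [cvar_resample] bounds the later terms by those of [F] itself. *)
Lemma efron_stein_seq l F : uniq l ->
  Expect (fdist_family d) (fun t => F t ^+ 2) -
  Expect (fdist_family d) (fun t => resamples l F t ^+ 2) <=
  \sum_(i <- l) Expect (fdist_family d) (cvar i F).
Proof.
elim: l F => [|i l IH] F /=; first by rewrite big_nil subrr.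
case/andP=> il ul; rewrite big_cons.
have := IH (resample i F) ul.
have le : \sum_(j <- l) Expect (fdist_family d) (cvar j (resample i F)) <=
          \sum_(j <- l) Expect (fdist_family d) (cvar j F).
  rewrite !big_seq; apply: ler_sum => j jl; apply: cvar_resample.
  by apply: contraNneq il => ->.
rewrite Expect_cvar; lra.
Qed.

Lemma efron_stein F :
  Variance (fdist_family d) F <= \sum_i Expect (fdist_family d) (cvar i F).
Proof.
have := efron_stein_seq F (enum_uniq I).
rewrite big_enum /=; apply: le_trans.
rewrite VarianceE lerD2l lerN2.
(* With every coordinate averaged out the function is constant, so its second moment is the squared
   mean of [F] and the telescoped difference is the variance. *)
have cst t t' : resamples (enum I) F t = resamples (enum I) F t'.
  apply: (@resamples_local _ [::]) => [u u' uu'|i]; last by rewrite cats0 mem_enum.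
  by congr F; apply/ffunP => i; exact: uu'.
have [t0|t0] := pickP {: {ffun I -> T}}.
  rewrite -(Expect_resamples (enum I) F).
  rewrite !(@eq_Expect _ _ _ _ (fun=> _) (fun t => cst t t0)) //.
  rewrite (@eq_Expect _ _ _ _ (fun=> (resamples (enum I) F t0) ^+ 2)).
    by rewrite !Expect_cst.
  by move=> t; rewrite (cst t t0).
by rewrite /Expect !big_pred0 // expr0n.
Qed.

End ProductLaws.

(** * Randomized Response *)

Section Debiasing.
Variables (R : realType) (eps : R).
Hypothesis eps_gt0 : 0 < eps.

Definition debias (c : bool) : R := ((expR eps + 1) * c%:R - 1) / (expR eps - 1).

Definition noise_var : R := expR eps / (expR eps - 1) ^+ 2.

Let e_gt1 : 1 < expR eps. Proof. by rewrite expR_gt1. Qed.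
Let e1_neq0 : expR eps - 1 != 0. Proof. by rewrite subr_eq0 gt_eqF. Qed.
Let eS_neq0 : expR eps + 1 != 0. Proof. by rewrite gt_eqF // addr_gt0 ?expR_gt0. Qed.

Lemma Expect_debias b : Expect (rr_bit eps b) debias = b%:R.
Proof.
rewrite /Expect big_bool /= /bit_pmf /debias /rr_keep.
by case: b => /=; field; rewrite e1_neq0 eS_neq0.
Qed.

Lemma Variance_debias b : Variance (rr_bit eps b) debias = noise_var.
Proof.
rewrite VarianceE Expect_debias /Expect big_bool /= /bit_pmf /debias /rr_keep /noise_var.
by case: b => /=; field; rewrite e1_neq0 eS_neq0.
Qed.

Lemma noise_var_ge0 : 0 <= noise_var.
Proof. by rewrite divr_ge0 ?sqr_ge0 ?expR_ge0. Qed.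

Lemma Expect_debias_sqr b :
  Expect (rr_bit eps b) (fun c => debias c ^+ 2) <= 1 + noise_var.
Proof.
have := Variance_debias b; rewrite VarianceE Expect_debias => <-.
by case: b; rewrite ?expr1n ?expr0n /=; lra.
Qed.

(** With [u = expR (eps / 2)], the square root of [noise_var] is [u / (u ^+ 2 - 1)], at most
    [1 / (u - 1)], and [u - 1] dominates each term [z] of positive degree in the exponential
    series. *)
Lemma noise_var_le k : noise_var <= (2 ^+ k.+1 * (k.+1)`!%:R) ^+ 2 / eps ^+ (k.+1).*2.
Proof.
pose y := eps / 2; have y0 : 0 < y by rewrite divr_gt0.
have f0 : 0 < (k.+1)`!%:R :> R by rewrite ltr0n fact_gt0.
pose z := y ^+ k.+1 / (k.+1)`!%:R.
have z0 : 0 < z by rewrite divr_gt0 ?exprn_gt0.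
have zy : z <= expR y - 1 by rewrite lerBrDl; exact/expR_ge1Dxn/ltW.
have eE : expR eps = expR y ^+ 2 by rewrite expr2 -expRD /y -splitr.
have u1 : 1 <= expR y by rewrite -lerBlDr in zy; lra.
have -> : (2 ^+ k.+1 * (k.+1)`!%:R) ^+ 2 / eps ^+ (k.+1).*2 = (z ^+ 2)^-1.
  rewrite /z /y -muln2 exprM !expr_div_n exprMn.
  have : eps ^+ k.+1 != 0 by rewrite expf_neq0 ?gt_eqF.
  have : (2 : R) ^+ k.+1 != 0 by rewrite expf_neq0 ?pnatr_eq0.
  move: (eps ^+ _) (2 ^+ _) f0 => a b f0 b0 a0.
  by field; rewrite gt_eqF // a0 b0.
rewrite /noise_var eE; set u := expR y in zy u1 *.
have u0 : 0 < u by rewrite /u expR_gt0.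
have v0 : 0 < u ^+ 2 - 1 by nra.
rewrite ler_pdivrMr ?exprn_gt0 // mulrC ler_pdivlMr ?exprn_gt0 //.
have uz0 : 0 <= u * z by rewrite mulr_ge0 // ltW.
by rewrite -exprMn ler_pXn2r ?nnegrE ?(ltW v0) //; nra.
Qed.

End Debiasing.

(** * Privacy of the reports *)

Section Privacy.
Variables (R : realType) (eps : R).
Hypothesis eps_gt0 : 0 < eps.

Lemma bit_pmf_ratio b b' c : bit_pmf eps b c <= expR eps * bit_pmf eps b' c.
Proof.
have e1 : 1 < expR eps by rewrite expR_gt1.
have e0 : 0 < expR eps + 1 by lra.
have keepE : rr_keep eps = expR eps * (1 - rr_keep eps).
  by rewrite /rr_keep; field; rewrite gt_eqF.
have k1 : 0 <= 1 - rr_keep eps.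
  by have := bit_pmf_ge0 eps true false; rewrite /bit_pmf.
rewrite /bit_pmf; move: (rr_keep eps) keepE k1 => k kE k1.
case: (c == b); case: (c == b'); nra.
Qed.

(** At most one factor differs, so the ratio [expR eps] is paid once. This serves both a single
    randomizer and the whole transcript. *)
Lemma prod_bit_pmf_ratio (I : finType) (b b' t : I -> bool) :
  (forall i j, b i != b' i -> b j != b' j -> i = j) ->
  \prod_i bit_pmf eps (b i) (t i) <= expR eps * \prod_i bit_pmf eps (b' i) (t i).
Proof.
move=> uniq_diff; have e1 : 1 < expR eps by rewrite expR_gt1.
have [i bi|eqb] := pickP (fun i => b i != b' i).
  rewrite (bigD1 i) //= [in leRHS](bigD1 i) //= mulrA.
  rewrite (eq_bigr (fun j => bit_pmf eps (b' j) (t j))).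
    rewrite ler_wpM2r ?bit_pmf_ratio // prodr_ge0 // => j _; exact: bit_pmf_ge0.
  move=> j ji; congr bit_pmf; apply/eqP; apply: contraNT ji => bj.
  by apply/eqP; exact: uniq_diff.
rewrite (eq_bigr (fun j => bit_pmf eps (b' j) (t j))).
  by apply: ler_peMl (ltW e1); rewrite prodr_ge0 // => j _; exact: bit_pmf_ge0.
by move=> j _; congr bit_pmf; apply/eqP; have /negbFE := eqb j.
Qed.

Lemma Pr_ratio (T : finType) (d d' : fdist R T) (Z : pred T) :
  (forall x, d x <= expR eps * d' x) -> Pr d Z <= expR eps * Pr d' Z.
Proof. by move=> le; rewrite /Pr mulr_sumr; apply: ler_sum. Qed.

Lemma rr_mask_private n (S : {set 'I_n}) :
  local_randomizer eps (fun a => rr eps (Defs.mask S a)).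
Proof.
move=> a a' /eqP/cards1P[k kE] Z; apply: Pr_ratio => t.
apply: prod_bit_pmf_ratio => i j.
have key l : Defs.mask S a l != Defs.mask S a' l -> l = k.
  rewrite !ffunE => ne; apply/set1P; rewrite -kE inE.
  by apply: contraNneq ne => ->.
by move=> /key-> /key->.
Qed.

End Privacy.

Lemma mem_edges n (G : sgraph n) i j : ([set i; j] \in edges G) = adj G i j.
Proof.
apply/imsetP/idP => [[[k l]]|ij]; last by exists (i, j); rewrite ?inE.
rewrite inE /= => kl e.
have := set21 i j; have := set22 i j; rewrite e !inE.
have : k \in [set i; j] by rewrite e set21.
have : l \in [set i; j] by rewrite e set22.
rewrite !inE.
do 4![case/orP => /eqP ?]; subst => //; rewrite ?(adj_irr G) // in kl *;
  by rewrite adj_sym.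
Qed.

(* Each pair is reported by its smaller endpoint. *)
Definition owned n (i : 'I_n) : {set 'I_n} := [set j : 'I_n | (i < j)%N].

(** Indexed by all ordered pairs, like the reports; a pair that is not increasing carries the masked
    bit 0. *)
Definition edge_bit n (G : sgraph n) (e : 'I_n * 'I_n) : bool :=
  (e.1 < e.2)%N && adj G e.1 e.2.

(** Only the increasing orientation of an edge carries its bit, so the single differing edge is
    visible at one position only. *)
Lemma edge_bit_neighbors n (G H : sgraph n) e f : edge_neighbors G H ->
  edge_bit G e != edge_bit H e -> edge_bit G f != edge_bit H f -> e = f.
Proof.
case: e f => [i j] [k l] /eqP/cards1P[s sE].
have key (e : 'I_n * 'I_n) : edge_bit G e != edge_bit H e ->
    (e.1 < e.2)%N /\ [set e.1; e.2] = s.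
  rewrite /edge_bit; case: (ltnP e.1 e.2) => //= _ ne; split=> //.
  apply/set1P; rewrite -sE !inE !mem_edges.
  by case: (adj G _ _) ne; case: (adj H _ _).
move=> /key[/= ij ijs] /key[/= kl]; rewrite -ijs => {ijs s sE key} e.
have : i \in [set k; l] by rewrite e set21.
have : j \in [set k; l] by rewrite e set22.
rewrite !inE => /orP[]/eqP jE /orP[]/eqP iE; subst => //.
- by rewrite ltnn in ij.
- by rewrite ltnNge ltnW in ij.
- by rewrite ltnn in ij.
Qed.

Section Transcript.
Variables (R : realType) (eps : R) (n : nat) (W : finType) (w : fdist R W).
Variable post : {ffun 'I_n -> {ffun 'I_n -> bool}} -> W -> R.
Let A := rr_alg eps (@owned n) w post.

Definition edge_law (G : sgraph n) : fdist R {ffun 'I_n * 'I_n -> bool} :=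
  fdist_family (fun e => rr_bit eps (edge_bit G e)).

Definition flatten_reports (t : {ffun 'I_n -> {ffun 'I_n -> bool}}) :
  {ffun 'I_n * 'I_n -> bool} := [ffun e => t e.1 e.2].

Lemma transcript_pmf G t :
  transcript_law A G t = \prod_e bit_pmf eps (edge_bit G e) (flatten_reports t e).
Proof.
transitivity (\prod_i \prod_j bit_pmf eps (edge_bit G (i, j)) (t i j)).
  apply: eq_bigr => i _; apply: eq_bigr => j _.
  by rewrite /rr_bit /= !ffunE inE.
by rewrite pair_bigA; apply: eq_bigr => -[i j] _; rewrite ffunE.
Qed.

(** Regrouping the vectors of all nodes into one family indexed by pairs is a bijection; it yields a
    single product law of independent bits, the form that Efron-Stein needs. *)
Lemma Expect_flatten G (F : {ffun 'I_n * 'I_n -> bool} -> R) :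
  Expect (transcript_law A G) (fun t => F (flatten_reports t)) =
  Expect (edge_law G) F.
Proof.
pose unflatten (u : {ffun 'I_n * 'I_n -> bool}) := [ffun i => [ffun j => u (i, j)]].
have unflattenK : cancel unflatten flatten_reports.
  by move=> u; apply/ffunP => -[i j]; rewrite !ffunE.
have flattenK : cancel flatten_reports unflatten.
  by move=> t; apply/ffunP => i; apply/ffunP => j; rewrite !ffunE.
rewrite /Expect [RHS](reindex flatten_reports); last first.
  by exists unflatten => t _.
by apply: eq_bigr => t _; rewrite transcript_pmf.
Qed.

Lemma rr_alg_ledp : 0 < eps -> ledp A eps.
Proof.
move=> eps0; split=> [i|G H GH Z]; first exact: rr_mask_private.
apply: Pr_ratio => t; rewrite !transcript_pmf; apply: prod_bit_pmf_ratio => // e f.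
exact: edge_bit_neighbors.
Qed.

End Transcript.

(** * Matrices, triangles and 4-cycles *)

Section SymmetricMatrices.
Variables (R : realType) (n : nat).
Implicit Types (M A : 'M[R]_n) (e f : 'I_n * 'I_n) (u : 'I_n * 'I_n -> R).

Definition sort_pair (i j : 'I_n) := if (i < j)%N then (i, j) else (j, i).

Lemma sort_pair_eq i j k l :
  (sort_pair i j == sort_pair k l) =
  (i == k) && (j == l) || (i == l) && (j == k).
Proof.
rewrite /sort_pair; case: (ltnP i j) => ij; case: (ltnP k l) => kl;
  rewrite xpair_eqE -!val_eqE /=; lia.
Qed.

(** Only sorted positions of [u] are read, so the reports on masked bits never enter the matrix. *)
Definition symx u : 'M[R]_n :=
  \matrix_(i, j) if i == j then 0 else u (sort_pair i j).

Lemma symx_diag u i : symx u i i = 0.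
Proof. by rewrite mxE eqxx. Qed.

Lemma symx_sym u i j : symx u i j = symx u j i.
Proof.
rewrite !mxE eq_sym; case: eqP => // _; congr u; apply/eqP.
by rewrite sort_pair_eq !eqxx orbT.
Qed.

Definition edge_mx e : 'M[R]_n := symx (fun f => (f == e)%:R).

Lemma edge_mx_owned e : (e.1 < e.2)%N ->
  edge_mx e = delta_mx e.1 e.2 + delta_mx e.2 e.1.
Proof.
case: e => k l /= kl; apply/matrixP => i j; rewrite !mxE.
have -> : (k, l) = sort_pair k l by rewrite /sort_pair kl.
rewrite sort_pair_eq; case: eqVneq => [<-|ij].
  have nkl : k != l by rewrite -val_eqE ltn_eqF.
  case: (eqVneq i k) => [->|_]; first by rewrite (negPf nkl) addr0.
  by rewrite andbF addr0.
case: (eqVneq i k) (eqVneq j l) => [ik|_] [jl|_]; rewrite /= ?andbF ?addr0 ?add0r //.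
by subst; rewrite (negPf ij) addr0.
Qed.

Lemma edge_mx_unowned e : ~~ (e.1 < e.2)%N -> edge_mx e = 0.
Proof.
case: e => k l /= kl; apply/matrixP => i j; rewrite !mxE.
case: eqVneq => // ij; rewrite /sort_pair.
have /negbTE nij: (i : nat) != j by rewrite val_eqE.
case: ltngtP nij => // ij' _; case: eqP => // -[? ?]; subst;
  by rewrite ij' in kl.
Qed.

Lemma symx_upd u e v :
  symx (fun f => if f == e then v else u f) = symx u + (v - u e) *: edge_mx e.
Proof.
apply/matrixP => i j; rewrite !mxE; case: ifP => _; first by rewrite mulr0 addr0.
by case: eqP => [->|_]; rewrite ?mulr1 ?mulr0 ?addr0 // addrC subrK.
Qed.

Lemma mxtrace_mul_delta A (i j : 'I_n) : \tr (A *m delta_mx i j) = A j i.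
Proof.
rewrite /mxtrace (bigD1 j) //= big1 ?addr0 => [|k kj].
  rewrite mxE (bigD1 i) //= mxE !eqxx mulr1 big1 ?addr0 // => k ki.
  by rewrite mxE (negPf ki) mulr0.
by rewrite mxE big1 // => l _; rewrite mxE (negPf kj) andbF mulr0.
Qed.

Lemma mul_mx_deltaE A (i j k l : 'I_n) : (A *m delta_mx i j) k l = A k i *+ (l == j).
Proof.
rewrite mxE (bigD1 i) //= mxE eqxx big1 ?addr0 => [|m mi].
  by case: eqP; rewrite ?mulr1 ?mulr0.
by rewrite mxE (negPf mi) mulr0.
Qed.

Lemma mul_delta_mxE A (i j k l : 'I_n) : (delta_mx i j *m A) k l = A j l *+ (k == i).
Proof.
rewrite mxE (bigD1 j) //= mxE eqxx andbT big1 ?addr0 => [|m mj].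
  by case: eqP; rewrite ?mul1r ?mul0r.
by rewrite mxE (negPf mj) andbF mul0r.
Qed.

Lemma edge_mx_sqr e : (e.1 < e.2)%N ->
  edge_mx e *m edge_mx e = delta_mx e.1 e.1 + delta_mx e.2 e.2.
Proof.
move=> lt; have ne : e.1 != e.2 by rewrite -val_eqE ltn_eqF.
rewrite edge_mx_owned // mulmxDl !mulmxDr !mul_delta_mx.
by rewrite !mul_delta_mx_0 ?add0r ?addr0 // eq_sym.
Qed.

Definition tri M : R := \tr (M *m M *m M) / 6.

(** The square of [D = edge_mx e] is diagonal while [M] and [D] have zero diagonal, so the terms in
    [a ^+ 2] and [a ^+ 3] have trace 0. The three linear terms have equal trace, twice the entry of
    [M *m M] at [e], which cancels the 6. *)
Lemma tri_edge u e (a : R) : let M := symx u in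
  tri (M + a *: edge_mx e) = tri M + a * ((M *m M) e.1 e.2 *+ (e.1 < e.2)%N).
Proof.
move=> M; case: (boolP (e.1 < e.2)%N) => [lt|nlt]; last first.
  by rewrite edge_mx_unowned // scaler0 addr0 mulr0 addr0.
set D := edge_mx e.
have trDD A : (forall i, A i i = 0) -> \tr (A *m (D *m D)) = 0.
  move=> A0; rewrite edge_mx_sqr // mulmxDr mxtraceD !mxtrace_mul_delta.
  by rewrite !A0 addr0.
have trMDD : \tr (M *m (D *m D)) = 0 by apply: trDD => i; exact: symx_diag.
have trDDD : \tr (D *m (D *m D)) = 0 by apply: trDD => i; exact: symx_diag.
have MMs i j : (M *m M) i j = (M *m M) j i.
  by rewrite !mxE; apply: eq_bigr => k _; rewrite mulrC ![symx _ _ k]symx_sym ![M k _]symx_sym.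
have trMMD : \tr (M *m M *m D) = 2 * (M *m M) e.1 e.2.
  rewrite /D edge_mx_owned // mulmxDr mxtraceD !mxtrace_mul_delta.
  by rewrite [X in X + _]MMs mulr2n mulrDl mul1r.
have t1 : \tr (M *m D *m M) = \tr (M *m M *m D) by rewrite mxtrace_mulC mulmxA.
have t2 : \tr (D *m M *m M) = \tr (M *m M *m D) by rewrite -mulmxA mxtrace_mulC.
have t3 : \tr (M *m D *m D) = 0 by rewrite -mulmxA.
have t4 : \tr (D *m M *m D) = 0 by rewrite -mulmxA mxtrace_mulC -mulmxA.
have t5 : \tr (D *m D *m M) = 0 by rewrite mxtrace_mulC.
have t6 : \tr (D *m D *m D) = 0 by rewrite -mulmxA.
rewrite /tri !(mulmxDl, mulmxDr) !(=^~ scalemxAl, =^~ scalemxAr) !mxtraceD !mxtraceZ.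
rewrite t1 t2 t3 t4 t5 t6 trMMD mulr1n; by field.
Qed.

(** The quadratic term is diagonal, hence absent at [i != j]; the slope collects the wedges from [i]
    to [j] that use [e]. *)
Lemma wedge_edge u e (a : R) i j : let M := symx u in i != j ->
  ((M + a *: edge_mx e) *m (M + a *: edge_mx e)) i j = (M *m M) i j +
  a * ((M i e.1 *+ (j == e.2) + M i e.2 *+ (j == e.1)
      + (M e.2 j *+ (i == e.1) + M e.1 j *+ (i == e.2))) *+ (e.1 < e.2)%N).
Proof.
move=> M ij; case: (boolP (e.1 < e.2)%N) => [lt|nlt]; last first.
  by rewrite edge_mx_unowned // scaler0 addr0 mulr0 addr0.
have DD0 : (edge_mx e *m edge_mx e) i j = 0.
  rewrite edge_mx_sqr // !mxE.
  by case: (eqVneq i e.1) (eqVneq i e.2) => [<-|_] [<-|_];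
    rewrite ?[j == _]eq_sym ?(negPf ij) ?addr0.
have MD : (M *m edge_mx e) i j = M i e.1 *+ (j == e.2) + M i e.2 *+ (j == e.1).
  by rewrite edge_mx_owned // mulmxDr mxE !mul_mx_deltaE.
have DM : (edge_mx e *m M) i j = M e.2 j *+ (i == e.1) + M e.1 j *+ (i == e.2).
  by rewrite edge_mx_owned // mulmxDl mxE !mul_delta_mxE.
rewrite -MD -DM mulr1n !(mulmxDl, mulmxDr) !(=^~ scalemxAl, =^~ scalemxAr).
move: (M *m M) (M *m edge_mx e) (edge_mx e *m M) (edge_mx e *m edge_mx e) DD0.
by move=> P Q S T T0; rewrite !mxE T0; ring.
Qed.

End SymmetricMatrices.

(** * The trace formula for triangles *)

Section GraphMatrices.
Variables (R : realType) (n : nat) (G : sgraph n).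

Definition adj_mx : 'M[R]_n := symx (fun e => (edge_bit G e)%:R).

Lemma adj_mxE i j : adj_mx i j = (adj G i j)%:R.
Proof.
rewrite mxE; case: eqVneq => [->|ij]; first by rewrite adj_irr.
rewrite /sort_pair /edge_bit; case: (ltnP i j) => /= [->//|ji].
by rewrite ltn_neqAle ji andbT val_eqE eq_sym ij adj_sym.
Qed.

Definition codeg i j : nat := #|[set k | adj G i k && adj G k j]|.

Lemma adj_mx_sqrE i j : (adj_mx *m adj_mx) i j = (codeg i j)%:R.
Proof.
rewrite mxE /codeg -sum1_card natr_sum [RHS]big_mkcond /=; apply: eq_bigr => k _.
by rewrite !adj_mxE inE -natrM mulnb; case: (_ && _).
Qed.

Lemma cards3E (S : {set 'I_n}) i j k : #|S| = 3%N ->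
  [&& i \in S, j \in S :\ i & k \in S :\ i :\ j] =
  (S == [set i; j; k]) && uniq [:: i; j; k].
Proof.
move=> S3; apply/idP/andP => [/and3P[iS jS kS]|[/eqP-> /=]]; last first.
  rewrite !inE !negb_or => /andP[/andP[ij ik]] /andP[jk _].
  by rewrite !eqxx ![_ == i]eq_sym ![k == j]eq_sym ij ik jk !orbT.
have u : uniq [:: i; j; k].
  move: jS kS; rewrite /= !inE => /andP[ji _] /and3P[kj ki _].
  by rewrite negb_or ![i == _]eq_sym [j == k]eq_sym ji ki kj.
split=> //; rewrite eq_sym eqEcard S3; apply/andP; split.
  apply/subsetP => x; rewrite !inE -orbA; move: jS kS; rewrite !inE.
  by move=> /andP[_ jS] /and3P[_ _ kS] /or3P[] /eqP->.
have -> : [set i; j; k] = [set:: [:: i; j; k]].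
  by apply/setP => x; rewrite !inE orbA.
by rewrite cardsE (card_uniqP u).
Qed.

Lemma triangle_sum :
  (\sum_i \sum_j \sum_k (adj G i j && adj G j k && adj G k i) =
   6 * #|triangles G|)%N.
Proof.
(* Double counting: the indicator of an ordered triple becomes a sum over triangles, with vertices
   drawn without replacement, so that each triangle is counted 3 * 2 * 1 times. *)
have indE i j k : (adj G i j && adj G j k && adj G k i : nat) =
    (\sum_(S in triangles G) (i \in S) * ((j \in S :\ i) * (k \in S :\ i :\ j)))%N.
  have E S : S \in triangles G -> ((i \in S) * ((j \in S :\ i) * (k \in S :\ i :\ j)) =
      (S == [set i; j; k]) && uniq [:: i; j; k] :> nat)%N.
    by rewrite inE => /andP[/eqP S3 _]; rewrite -cards3E // !mulnb.
  rewrite (eq_bigr _ E); case: (boolP (uniq _)) => [u|nu]; last first.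
    rewrite big1 => [|S _]; last by rewrite andbF.
    move: nu; rewrite /= !inE.
    case: (eqVneq i j) => [->|_]; first by rewrite adj_irr.
    case: (eqVneq i k) => [->|_]; first by rewrite adj_irr andbF.
    case: (eqVneq j k) => [->|_]; first by rewrite adj_irr andbF.
    by [].
  have c3 : #|[set i; j; k]| = 3%N.
    have -> : [set i; j; k] = [set:: [:: i; j; k]].
      by apply/setP => x; rewrite !inE orbA.
    by rewrite cardsE (card_uniqP u).
  have tE : ([set i; j; k] \in triangles G) = adj G i j && adj G j k && adj G k i.
    rewrite inE c3 eqxx /=; apply/forall_inP/idP => [h|].
      have a x y : x \in [set i; j; k] -> y \in [set i; j; k] -> x != y -> adj G x y.
        by move=> xS yS; have /forall_inP/(_ y yS)/implyP := h x xS.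
      move: u; rewrite /= !inE negb_or => /andP[/andP[ij ik]] /andP[jk _].
      by rewrite !a // ?inE ?eqxx ?orbT // eq_sym.
    case/andP=> /andP[ij jk] ki x xS; apply/forall_inP => y yS; apply/implyP => xy.
    move: xS yS xy; rewrite !inE -!orbA => /or3P[]/eqP-> /or3P[]/eqP->;
      by rewrite ?eqxx // adj_sym.
  case: (boolP ([set i; j; k] \in triangles G)) => [t|nt].
    rewrite -tE t (bigD1 _ t) /= eqxx big1 // => S /andP[_ /negPf->] //.
  rewrite -tE (negPf nt) big1 // => S St.
  by case: eqP => // SE; rewrite -SE St in nt.
under eq_bigr => i _ do under eq_bigr => j _ do
  (under eq_bigr => k _ do rewrite indE; rewrite exchange_big).
under eq_bigr => i _ do rewrite exchange_big.
rewrite exchange_big mulnC -sum_nat_const; apply: eq_bigr => S.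
rewrite inE => /andP[/eqP S3 _].
have memE (A : {set 'I_n}) : (\sum_i (i \in A) = #|A|)%N.
  by rewrite -sum1_card [RHS]big_mkcond /=; apply: eq_bigr => x _; case: (x \in A).
transitivity (\sum_i (i \in S) * 2)%N; last by rewrite -big_distrl memE S3.
apply: eq_bigr => i _; case: (boolP (i \in S)) => iS; last first.
  by rewrite big1 // => j _; rewrite big1.
have S2 : #|S :\ i| = 2%N by have := cardsD1 i S; rewrite iS S3 => -[].
transitivity (\sum_j (j \in S :\ i))%N; last by rewrite memE S2.
apply: eq_bigr => j _; case: (boolP (j \in S :\ i)) => jS; last first.
  by rewrite big1.
transitivity (\sum_k (k \in S :\ i :\ j))%N.
  by apply: eq_bigr => k _; rewrite !mul1n.
by rewrite memE; have := cardsD1 j (S :\ i); rewrite jS S2 add1n => -[<-].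
Qed.

Lemma tri_adj_mx : tri adj_mx = #|triangles G|%:R.
Proof.
rewrite /tri /mxtrace.
have -> : \sum_i (adj_mx *m adj_mx *m adj_mx) i i =
    (\sum_i \sum_j \sum_k (adj G i j && adj G j k && adj G k i))%N%:R.
  rewrite natr_sum; apply: eq_bigr => i _; rewrite exchange_big natr_sum mxE.
  apply: eq_bigr => k _; rewrite mxE mulr_suml natr_sum; apply: eq_bigr => j _.
  by rewrite !adj_mxE -!natrM !mulnb.
by rewrite triangle_sum natrM mulrC mulKf // pnatr_eq0.
Qed.

End GraphMatrices.

(** * Rooted 4-cycles and codegrees *)

Section FourCycles.
Variables (n : nat) (G : sgraph n).

(* The quadruple [((a, c), (b, d))] stands for the rooted 4-cycle [a b c d]. *)
Definition rooted_cycles : {set ('I_n * 'I_n) * ('I_n * 'I_n)} :=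
  [set q | [&& uniq [:: q.1.1; q.2.1; q.1.2; q.2.2], adj G q.1.1 q.2.1,
            adj G q.2.1 q.1.2, adj G q.1.2 q.2.2 & adj G q.2.2 q.1.1]].

Definition unroot (q : ('I_n * 'I_n) * ('I_n * 'I_n)) : {set {set 'I_n}} :=
  [set [set q.1.1; q.2.1]; [set q.2.1; q.1.2]; [set q.1.2; q.2.2]; [set q.2.2; q.1.1]].

Lemma four_cyclesE : four_cycles G = unroot @: rooted_cycles.
Proof.
apply/setP => F; rewrite inE; apply/idP/imsetP.
  case/existsP=> a /existsP[b /existsP[c /existsP[d]]].
  case/and5P=> u ab bc cd /andP[da /eqP->]; exists ((a, c), (b, d)) => //.
  by rewrite inE; apply/and5P.
case=> -[[a c] [b d]]; rewrite inE => /and5P[u ab bc cd da] ->.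
apply/existsP; exists a; apply/existsP; exists b.
apply/existsP; exists c; apply/existsP; exists d.
by rewrite u ab bc cd da eqxx.
Qed.

Lemma four_cycles_le : (#|four_cycles G| <= #|rooted_cycles|)%N.
Proof. by rewrite four_cyclesE leq_imset_card. Qed.

Lemma cover_unroot q : cover (unroot q) = [set q.1.1; q.2.1; q.1.2; q.2.2].
Proof.
apply/setP => x; rewrite /cover /unroot !bigcup_setU !big_set1 !inE.
by do 4![case: (x == _)].
Qed.

(** The edge set determines the at most 4 vertices as its [cover], which leaves at most 4^4 = 256
    rootings; this crude count only affects the constant. *)
Lemma rooted_cycles_le : (#|rooted_cycles| <= 256 * #|four_cycles G|)%N.
Proof.
rewrite -sum1_card (partition_big unroot (mem (four_cycles G))) /=; last first.
  by move=> q qr; rewrite four_cyclesE imset_f.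
rewrite mulnC -sum_nat_const; apply: leq_sum => F _; rewrite sum1dep_card.
have [q0 /andP[_ /eqP q0F]|none] :=
  pickP (fun q => (q \in rooted_cycles) && (unroot q == F)); last first.
  by rewrite (_ : [set _ | _] = set0) ?cards0 //; apply/setP => q; rewrite !inE -[RHS](none q) inE.
have V4 : (#|cover F| <= 4)%N.
  have -> : cover F = [set:: [:: q0.1.1; q0.2.1; q0.1.2; q0.2.2]].
    by rewrite -q0F cover_unroot; apply/setP => x; rewrite !inE -!orbA.
  by rewrite cardsE; exact: card_size.
apply: leq_trans (_ : #|setX (setX (cover F) (cover F)) (setX (cover F) (cover F))| <= _)%N.
  apply/subset_leq_card/subsetP => q; rewrite inE => /andP[_ /eqP <-].
  by rewrite cover_unroot; case: q => -[a c] [b d]; rewrite !inE !eqxx !orbT.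
rewrite !cardsX; exact: (@leq_mul _ _ 16 16 (@leq_mul _ _ 4 4 V4 V4) (@leq_mul _ _ 4 4 V4 V4)).
Qed.

Lemma card_offdiag (T : finType) (A : {set T}) :
  #|[set p : T * T | [&& p.1 \in A, p.2 \in A & p.1 != p.2]]| = (#|A| * #|A|.-1)%N.
Proof.
rewrite -sum1_card -sum_nat_const.
rewrite (eq_bigl (fun p : T * T => (p.1 \in A) && (p.2 \in A :\ p.1))); last first.
  by move=> p; rewrite !inE [p.2 == _]eq_sym [_ && (p.2 \in A)]andbC.
rewrite -(pair_big_dep (mem A) (fun i j => j \in A :\ i) (fun _ _ => 1%N)) /=.
apply: eq_bigr => i iA; rewrite sum1_card.
by have := cardsD1 i A; rewrite iA => ->.
Qed.

(** Once the opposite corners [a] and [c] are fixed, [b] and [d] range over the ordered pairs of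
    distinct common neighbours. *)
Lemma card_rooted_cycles : #|rooted_cycles| =
  (\sum_i \sum_(j | i != j) codeg G i j * (codeg G i j).-1)%N.
Proof.
rewrite pair_big_dep /= -sum1_card.
pose P (p q : 'I_n * 'I_n) := (p, q) \in rooted_cycles.
rewrite (eq_bigl (fun r => (xpredT r.1) && P r.1 r.2)); last by case.
rewrite -(pair_big_dep xpredT P (fun _ _ => 1%N)) /=.
rewrite [RHS]big_mkcond; apply: eq_bigr => -[a c] _ /=.
rewrite /codeg -card_offdiag -sum1_card; case: (eqVneq a c) => [<-|ac] /=.
  by rewrite big_pred0 // => -[b d]; rewrite /P inE /= !inE eqxx ?orbT ?andbF.
apply: eq_bigl => -[b d]; rewrite /P !inE /=.
rewrite (adj_sym G d a) (adj_sym G c d).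
case: (boolP (adj G a b)) => ab; rewrite ?andbF //=.
case: (boolP (adj G b c)) => bc; rewrite ?andbF //=.
case: (boolP (adj G d c)) => dc; rewrite ?andbF //=.
case: (boolP (adj G a d)) => ad; rewrite ?andbF //=.
have ne x y : adj G x y -> x != y by apply: contraTneq => ->; rewrite adj_irr.
rewrite !inE !negb_or (ne a b) // (ne a d) // (ne b c) // ac [c == d]eq_sym (ne d c) //.
by rewrite /= ?andbT.
Qed.

End FourCycles.

(** * Moments of the noisy counts *)

Section Moments.
Variables (R : realType) (eps : R) (n : nat) (G : sgraph n).
Hypothesis eps_gt0 : 0 < eps.
Let s := noise_var eps.
Let mu := edge_law eps G.
Implicit Types t : {ffun 'I_n * 'I_n -> bool}.

Definition noisy_mx (u : {ffun 'I_n * 'I_n -> bool}) : 'M[R]_n :=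
  symx (fun e => debias eps (u e)).

Lemma noisy_mx_upd t e b : noisy_mx (upd t e b) =
  noisy_mx t + (debias eps b - debias eps (t e)) *: edge_mx R e.
Proof.
rewrite -symx_upd; apply/matrixP => i j; rewrite !mxE ffunE.
by case: (_ == e).
Qed.

Lemma Expect_debias_prod (es : seq ('I_n * 'I_n)) : uniq es ->
  Expect mu (fun t => \prod_(e <- es) debias eps (t e)) =
  \prod_(e <- es) (edge_bit G e)%:R.
Proof.
move=> ues; rewrite (Expect_prod _ (fun=> debias eps)) //.
by apply: eq_bigr => e _; rewrite Expect_debias.
Qed.

(** For [i != j] the two off-diagonal entries come from distinct pairs and are independent; a
    diagonal entry makes both sides 0. *)
Lemma Expect_noisy2 i j k : i != j ->
  Expect mu (fun t => noisy_mx t i k * noisy_mx t k j) =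
  adj_mx R G i k * adj_mx R G k j.
Proof.
move=> ij; rewrite /noisy_mx /adj_mx.
under eq_Expect => t do rewrite !mxE.
rewrite !mxE; case: (eqVneq i k) => [|ik].
  by under eq_Expect do rewrite mul0r; rewrite Expect_cst mul0r.
case: (eqVneq k j) => [|kj].
  by under eq_Expect do rewrite mulr0; rewrite Expect_cst mulr0.
have := @Expect_debias_prod [:: sort_pair i k; sort_pair k j].
rewrite !big_cons big_nil mulr1 => <-; last first.
  by rewrite /= inE sort_pair_eq (negPf ik) (negPf ij).
by apply: eq_Expect => t; rewrite !big_cons big_nil mulr1.
Qed.

Lemma Expect_noisy3 i j k :
  Expect mu (fun t => noisy_mx t i j * noisy_mx t j k * noisy_mx t k i) =
  adj_mx R G i j * adj_mx R G j k * adj_mx R G k i.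
Proof.
rewrite /noisy_mx /adj_mx; under eq_Expect => t do rewrite !mxE.
rewrite !mxE; case: (eqVneq i j) => [|ij].
  by under eq_Expect do rewrite !mul0r; rewrite Expect_cst !mul0r.
case: (eqVneq j k) => [|jk].
  by under eq_Expect do rewrite mulr0 mul0r; rewrite Expect_cst mulr0 mul0r.
case: (eqVneq k i) => [|ki].
  by under eq_Expect do rewrite mulr0; rewrite Expect_cst mulr0.
have := @Expect_debias_prod [:: sort_pair i j; sort_pair j k; sort_pair k i].
rewrite !big_cons big_nil mulr1 mulrA => <-; last first.
  rewrite /= !inE !sort_pair_eq negb_or.
  by rewrite [j == i]eq_sym [i == k]eq_sym (negPf ij) (negPf jk) (negPf ki) ?andbF.
by apply: eq_Expect => t; rewrite !big_cons big_nil mulr1 mulrA.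
Qed.

Lemma Expect_noisy_sqr i j : Expect mu (fun t => noisy_mx t i j ^+ 2) <= 1 + s.
Proof.
rewrite /noisy_mx; under eq_Expect => t do rewrite !mxE.
case: eqP => _; first by rewrite expr0n Expect_cst addr_ge0 ?noise_var_ge0.
set e := sort_pair i j.
have := @Expect_prod R _ _ (fun f => rr_bit eps (edge_bit G f)) [:: e]
  (fun=> fun b => debias eps b ^+ 2) isT.
rewrite big_cons big_nil mulr1; set X := Expect _ _ => XE.
have -> : Expect mu (fun t => debias eps (t e) ^+ 2) = X.
  by apply: eq_Expect => t; rewrite big_cons big_nil mulr1.
by rewrite XE; exact: Expect_debias_sqr.
Qed.

Definition wedges i j t := (noisy_mx t *m noisy_mx t) i j.

Lemma Expect_wedges i j : i != j -> Expect mu (wedges i j) = (codeg G i j)%:R.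
Proof.
move=> ij; rewrite -adj_mx_sqrE mxE -(eq_bigr _ (fun k _ => Expect_noisy2 k ij)).
by rewrite -Expect_sum; apply: eq_Expect => t; rewrite /wedges mxE.
Qed.

Lemma Expect_tri : Expect mu (fun t => tri (noisy_mx t)) = #|triangles G|%:R.
Proof.
rewrite -(tri_adj_mx R) /tri /mxtrace.
under eq_Expect => t do rewrite mulrC.
rewrite ExpectZ mulrC; congr (_ / _).
rewrite Expect_sum; apply: eq_bigr => i _.
transitivity (\sum_k \sum_j adj_mx R G i j * adj_mx R G j k * adj_mx R G k i).
  rewrite -(eq_bigr _ (fun k _ => eq_bigr _ (fun j _ => Expect_noisy3 i j k))).
  under eq_bigr do rewrite -Expect_sum.
  rewrite -Expect_sum; apply: eq_Expect => t; rewrite mxE.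
  by apply: eq_bigr => k _; rewrite [X in X * _ = _]mxE mulr_suml.
by rewrite mxE; apply: eq_bigr => k _; rewrite [X in _ = X * _]mxE mulr_suml.
Qed.

(* The estimator is affine in each reported bit, with slope the noisy wedge
   count, and the Efron-Stein inequality only involves these slopes. *)
Lemma Variance_tri_le : Variance mu (fun t => tri (noisy_mx t)) <=
  s * \sum_i \sum_(j | i != j) Expect mu (fun t => wedges i j t ^+ 2).
Proof.
apply: le_trans (efron_stein _ _) _.
rewrite (pair_big_dep xpredT (fun i j => i != j)
  (fun i j => Expect mu (fun t => wedges i j t ^+ 2))) /=.
rewrite mulr_sumr [leRHS]big_mkcond /=; apply: ler_sum => e _.
pose c := wedges e.1 e.2.
rewrite (_ : Expect _ _ = Expect mu (fun t => s * (c t *+ (e.1 < e.2)%N) ^+ 2)).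
  rewrite ExpectZ; case: ifP => [_|/eqP ->].
    rewrite ler_wpM2l ?noise_var_ge0 //; apply: le_Expect => t.
    by case: (e.1 < e.2)%N; rewrite // mulr0n expr0n sqr_ge0.
  rewrite ltnn; under eq_Expect do rewrite mulr0n expr0n /=.
  by rewrite Expect_cst mulr0.
apply: eq_Expect => t; rewrite /cvar mulrC /s -(Variance_debias eps_gt0 (edge_bit G e)).
apply: (@Variance_affine _ _ _ _ _ (tri (noisy_mx t) -
  debias eps (t e) * (c t *+ (e.1 < e.2)%N))) => b.
rewrite noisy_mx_upd tri_edge -[X in _ + _ * X = _]/(c t *+ (e.1 < e.2)%N).
by move: (c t *+ _) => y; ring.
Qed.

(** By Efron-Stein only the pairs meeting [i] or [j] contribute. A slope is a sum of at most four
    entries of second moment at most [1 + s], and the incidences [hits] total [4 * n], whence 16. *)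
Lemma Variance_wedges_le i j : i != j ->
  Variance mu (wedges i j) <= 16 * n%:R * (s * (1 + s)).
Proof.
move=> ij; apply: le_trans (efron_stein _ _) _.
pose slope (e : 'I_n * 'I_n) t := let M := noisy_mx t in
  (M i e.1 *+ (j == e.2) + M i e.2 *+ (j == e.1)
   + (M e.2 j *+ (i == e.1) + M e.1 j *+ (i == e.2))) *+ (e.1 < e.2)%N.
pose hits (e : 'I_n * 'I_n) : R :=
  (j == e.2)%:R + (j == e.1)%:R + (i == e.1)%:R + (i == e.2)%:R.
have s0 : 0 <= s by exact: noise_var_ge0.
have cvarE e : Expect mu (cvar (fun f => rr_bit eps (edge_bit G f)) e (wedges i j)) =
    s * Expect mu (fun t => slope e t ^+ 2).
  rewrite -ExpectZ; apply: eq_Expect => t.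
  rewrite /cvar mulrC /s -(Variance_debias eps_gt0 (edge_bit G e)).
  apply: (@Variance_affine _ _ _ _ _ (wedges i j t - debias eps (t e) * slope e t)) => b.
  rewrite [LHS]/wedges noisy_mx_upd wedge_edge //.
  rewrite -[X in _ + _ * X = _]/(slope e t) -[X in X + _ = _]/(wedges i j t).
  by move: (slope e t) => y; ring.
have slope_le e : Expect mu (fun t => slope e t ^+ 2) <= 4 * (1 + s) * hits e.
  pose bound t := let M := noisy_mx t in
    4 * ((j == e.2)%:R * M i e.1 ^+ 2 + (j == e.1)%:R * M i e.2 ^+ 2
         + (i == e.1)%:R * M e.2 j ^+ 2 + (i == e.2)%:R * M e.1 j ^+ 2).
  apply: (@le_trans _ _ (Expect mu bound)).
    have sqM (x : R) (b : bool) : b%:R * x ^+ 2 = (x *+ b) ^+ 2.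
      by case: b; rewrite ?mul1r ?mul0r ?expr0n.
    have sq4 (a b c d : R) : (a + b + (c + d)) ^+ 2 <=
        4 * (a ^+ 2 + b ^+ 2 + c ^+ 2 + d ^+ 2).
      have := sqr_ge0 (a - b); have := sqr_ge0 (a - c); have := sqr_ge0 (a - d).
      have := sqr_ge0 (b - c); have := sqr_ge0 (b - d); have := sqr_ge0 (c - d).
      by rewrite !expr2; lra.
    apply: le_Expect => t; rewrite /slope /bound /= !sqM.
    apply: le_trans (sq4 _ _ _ _); case: (e.1 < e.2)%N => //.
    by rewrite mulr0n expr0n sqr_ge0.
  rewrite /bound ExpectZ !ExpectD !ExpectZ -mulrA ler_pM2l // [leRHS]mulrC !mulrDl.
  by do ![apply: lerD]; rewrite ler_wpM2l ?ler0n ?Expect_noisy_sqr.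
rewrite (eq_bigr _ (fun e _ => cvarE e)) -mulr_sumr.
have sum_hits : \sum_e hits e = 4 * n%:R.
  rewrite /hits -(pair_bigA _ (fun k l => (j == l)%:R + (j == k)%:R + (i == k)%:R + (i == l)%:R)) /=.
  have one (a : 'I_n) : \sum_b ((a == b)%:R : R) = 1.
    by rewrite (bigD1 a) //= eqxx big1 ?addr0 // => b /negPf; rewrite eq_sym => ->.
  have const (c : R) : \sum_(b : 'I_n) c = n%:R * c.
    by rewrite sumr_const card_ord mulr_natl.
  under eq_bigr => k _ do rewrite !big_split /= !one !const.
  rewrite !big_split /= -!mulr_sumr !one !const; ring.
apply: (@le_trans _ _ (s * (4 * (1 + s) * (4 * n%:R)))).
  by rewrite ler_wpM2l // -sum_hits mulr_sumr; apply: ler_sum => e _.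
by rewrite (_ : _ * _ = 16 * n%:R * (s * (1 + s))) //; ring.
Qed.

End Moments.

(** * The estimator *)

Section Estimator.
Variables (R : realType) (eps : R) (n : nat).
Hypothesis eps_gt0 : 0 < eps.
Let s := noise_var eps.

Definition excess (x : R) : R := Num.max 0 (x - 1).

(** [excess] is 1-Lipschitz. This passes from noisy to true codegrees at the cost of the wedge
    variance. *)
Lemma excess_sqr_le (x y : R) : excess x ^+ 2 <= 2 * excess y ^+ 2 + 2 * (x - y) ^+ 2.
Proof.
rewrite /excess (_ : x - y = (x - 1) - (y - 1)); last by ring.
move: (x - 1) (y - 1) => a b; have := sqr_ge0 (a - 2 * b); have := sqr_ge0 (a - b).
case: (lerP 0 a) => a0; case: (lerP 0 b) => b0; rewrite ?expr0n /=; [lra|nra|nra|lra].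
Qed.

Lemma excess_nat_le m : excess m%:R ^+ 2 <= (m * m.-1)%N%:R.
Proof.
case: m => [|[|m]]; rewrite /excess.
- by rewrite sub0r max_l ?lerN10 // expr0n.
- by rewrite subrr maxxx expr0n.
have m0 : 0 <= m%:R :> R by rewrite ler0n.
by rewrite /= natrM -[m.+2]addn2 -[m.+1]addn1 !natrD max_r; nra.
Qed.

Lemma excess_nat_ge m : (m * m.-1)%N%:R <= 2 * excess m%:R ^+ 2.
Proof.
case: m => [|[|m]]; rewrite /excess; try by rewrite mul0n mulr_ge0 ?sqr_ge0.
  by rewrite muln0 mulr_ge0 ?sqr_ge0.
have m0 : 0 <= m%:R :> R by rewrite ler0n.
by rewrite /= natrM -[m.+2]addn2 -[m.+1]addn1 !natrD max_r; nra.
Qed.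

(* The excess over 1, rather than the codegree itself, keeps the added variance
   bounded by the number of 4-cycles: a star has many pairs with one common
   neighbour but no 4-cycle. *)
Definition noise_sqr (M : 'M[R]_n) : R :=
  (\sum_i \sum_(j | i != j) excess ((M *m M) i j) ^+ 2) / eps ^+ 2
  + n%:R ^+ 3 / eps ^+ 6.

Lemma noise_sqr_ge0 M : 0 <= noise_sqr M.
Proof.
rewrite addr_ge0 ?divr_ge0 ?exprn_ge0 ?(ltW eps_gt0) //.
by apply: sumr_ge0 => i _; apply: sumr_ge0 => j _; exact: sqr_ge0.
Qed.

(** * Bounds for the added noise and for the variance of the trace *)

Section Rates.
Variable G : sgraph n.
Let mu := edge_law eps G.
Let C : R := #|rooted_cycles G|%:R.

Lemma rooted_cyclesE :
  C = \sum_i \sum_(j | i != j) (codeg G i j * (codeg G i j).-1)%N%:R.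
Proof.
rewrite /C card_rooted_cycles natr_sum; apply: eq_bigr => i _.
by rewrite natr_sum.
Qed.

Lemma Expect_noise_sqr : Expect mu (fun t => noise_sqr (noisy_mx eps t)) =
  (\sum_i \sum_(j | i != j) Expect mu (fun t => excess (wedges eps i j t) ^+ 2)) / eps ^+ 2
  + n%:R ^+ 3 / eps ^+ 6.
Proof.
rewrite /noise_sqr ExpectD Expect_cst; congr (_ + _).
under eq_Expect do rewrite mulrC.
rewrite ExpectZ mulrC Expect_sum; congr (_ / _).
by apply: eq_bigr => i _; rewrite Expect_sum.
Qed.

Lemma noise_sqr_lower :
  C / 2 / eps ^+ 2 + n%:R ^+ 3 / eps ^+ 6 <=
  Expect mu (fun t => noise_sqr (noisy_mx eps t)).
Proof.
rewrite Expect_noise_sqr lerD2r ler_wpM2r ?invr_ge0 ?sqr_ge0 //.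
rewrite rooted_cyclesE mulr_suml; apply: ler_sum => i _.
rewrite mulr_suml; apply: ler_sum => j ij.
rewrite ler_pdivrMr // mulrC; apply: le_trans (excess_nat_ge _) _.
rewrite ler_pM2l //.
(* Jensen's inequality is used twice: here for the square, then for [excess], a maximum of two
   affine functions. *)
apply: le_trans (Expect_sqr_le _ _).
have E0 : 0 <= Expect mu (fun t => excess (wedges eps i j t)).
  by apply: Expect_ge0 => t; rewrite le_max lexx.
have e0 : 0 <= excess ((codeg G i j)%:R) by rewrite le_max lexx.
rewrite ler_pXn2r ?nnegrE // ge_max E0 /= -(Expect_wedges G eps_gt0 ij).
rewrite -[- 1](Expect_cst mu) -ExpectD; apply: le_Expect => t.
by rewrite le_max lexx orbT.
Qed.

Let v : R := 16 * n%:R * (s * (1 + s)).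

Let s_ge0 : 0 <= s. Proof. exact: noise_var_ge0. Qed.
Let v_ge0 : 0 <= v. Proof. exact: mulr_ge0 (mulr_ge0 (ler0n _ 16) (ler0n _ n)) (mulr_ge0 s_ge0 (addr_ge0 ler01 s_ge0)). Qed.

Lemma sum_offdiag_le (F : 'I_n -> 'I_n -> R) (a b : R) : 0 <= b ->
  (forall i j, i != j -> F i j <= a * (codeg G i j * (codeg G i j).-1)%N%:R + b) ->
  \sum_i \sum_(j | i != j) F i j <= a * C + n%:R ^+ 2 * b.
Proof.
move=> b0 FE; rewrite rooted_cyclesE mulr_sumr.
have -> : n%:R ^+ 2 * b = \sum_(i < n) n%:R * b.
  by rewrite sumr_const card_ord -[RHS]mulr_natl; ring.
rewrite -big_split; apply: ler_sum => i _.
have -> : n%:R * b = \sum_(j < n) b by rewrite sumr_const card_ord -[RHS]mulr_natl.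
apply: (@le_trans _ _ (\sum_(j | i != j)
    (a * (codeg G i j * (codeg G i j).-1)%N%:R + b))).
  by apply: ler_sum => j; exact: FE.
rewrite big_split /= mulr_sumr lerD2l big_mkcond /=; apply: ler_sum => j _.
by case: ifP.
Qed.

Lemma noise_sqr_upper : Expect mu (fun t => noise_sqr (noisy_mx eps t)) <=
  (2 * C + n%:R ^+ 2 * (2 * v)) / eps ^+ 2 + n%:R ^+ 3 / eps ^+ 6.
Proof.
rewrite Expect_noise_sqr lerD2r ler_wpM2r ?invr_ge0 ?sqr_ge0 //.
apply: sum_offdiag_le => [|i j ij]; first by rewrite mulr_ge0.
apply: (@le_trans _ _ (Expect mu (fun t => 2 * excess (codeg G i j)%:R ^+ 2
    + 2 * (wedges eps i j t - (codeg G i j)%:R) ^+ 2))).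
  by apply: le_Expect => t; exact: excess_sqr_le.
rewrite ExpectD !ExpectZ Expect_cst lerD ?ler_pM2l ?excess_nat_le //.
rewrite -(Expect_wedges G eps_gt0 ij); exact: Variance_wedges_le.
Qed.

Lemma Variance_tri_upper : Variance mu (fun t => tri (noisy_mx eps t)) <=
  s * (2 * C + n%:R ^+ 2 * (1 + v)).
Proof.
apply: le_trans (Variance_tri_le G eps_gt0) _; rewrite ler_wpM2l //.
apply: sum_offdiag_le => [|i j ij]; first by rewrite addr_ge0.
have := Variance_wedges_le G eps_gt0 ij; rewrite VarianceE Expect_wedges // lerBlDr.
move/le_trans; apply; rewrite -/s -/v addrC addrA lerD2r.
(* What remains is [d ^+ 2 <= 2 * d * (d - 1) + 1] for the codegree [d]; the 1 covers pairs with a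
   single common neighbour and costs [s * n ^+ 2] in total. *)
case: (codeg G i j) => [|m]; first by rewrite expr0n mul0n mulr0 add0r.
rewrite /= -addn1 natrM natrD; have : 0 <= m%:R :> R by rewrite ler0n.
have : m%:R <= m%:R ^+ 2 :> R.
  by rewrite -natrX ler_nat; case: (m) => // k; rewrite expnS leq_pmulr.
by rewrite !expr2; lra.
Qed.

Lemma upper_rate :
  s * (2 * C + n%:R ^+ 2 * (1 + v)) +
  ((2 * C + n%:R ^+ 2 * (2 * v)) / eps ^+ 2 + n%:R ^+ 3 / eps ^+ 6) <=
  100 ^+ 2 * variance_rate eps G.
Proof.
have C_le : C <= 256 * #|four_cycles G|%:R.
  by rewrite -natrM ler_nat; exact: rooted_cycles_le.
have C0 : 0 <= C by exact: ler0n.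
have n23 : n%:R ^+ 2 <= n%:R ^+ 3 :> R.
  by rewrite -!natrX ler_nat; case: (n) => // k; rewrite leq_pexp2l.
have N0 : 0 <= n%:R ^+ 3 :> R by rewrite exprn_ge0.
have N20 : 0 <= n%:R ^+ 2 :> R by rewrite exprn_ge0.
have c0 : 0 < (eps ^+ 2)^-1 by rewrite invr_gt0 exprn_gt0.
have s_le k a : (2 ^+ k.+1 * (k.+1)`!%:R) ^+ 2 = a -> s <= a * ((eps ^+ 2)^-1) ^+ k.+1.
  by move=> <-; rewrite exprVn -exprM mul2n; exact: noise_var_le.
(* The constants are [(2 * 1!) ^+ 2], [(4 * 2!) ^+ 2] and [(8 * 3!) ^+ 2]. The first bound serves
   the 4-cycle terms; products of the three bring every other term to order [eps ^- 6]. *)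
have s1 : s <= 4 * (eps ^+ 2)^-1.
  by apply: (s_le 0); rewrite (_ : 1`! = 1)%N //; ring.
have s2 : s <= 64 * ((eps ^+ 2)^-1) ^+ 2.
  by apply: s_le; rewrite (_ : 2`! = 2)%N //; ring.
have s3 : s <= 2304 * ((eps ^+ 2)^-1) ^+ 3.
  by apply: s_le; rewrite (_ : 3`! = 6)%N //; ring.
rewrite /variance_rate /v.
have -> : (eps ^+ 6)^-1 = ((eps ^+ 2)^-1) ^+ 3 by rewrite exprVn -exprM.
move: (eps ^+ 2)^-1 c0 s1 s2 s3 => c c0 s1 s2 s3.
move: (n%:R : R) (ler0n R n) n23 N0 N20 => m m0 n23 N0 N20.
move: (#|four_cycles G|%:R : R) (ler0n R #|four_cycles G|) C C0 C_le => F F0 D D0 D_le.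
have ss : s * s <= 256 * c ^+ 3.
  rewrite (_ : 256 * _ = (4 * c) * (64 * c ^+ 2)); last by ring.
  by apply: ler_pM.
have sss : s * s * s <= 64 * c ^+ 3.
  rewrite (_ : 64 * _ = (4 * c) * (4 * c) * (4 * c)); last by ring.
  by apply: ler_pM => //; [exact: mulr_ge0 | exact: ler_pM].
have cs : c * s <= 64 * c ^+ 3.
  by rewrite (_ : 64 * _ = c * (64 * c ^+ 2)) ?ler_pM2l //; ring.
have css : c * (s * s) <= 16 * c ^+ 3.
  rewrite (_ : 16 * _ = c * ((4 * c) * (4 * c))); last by ring.
  by rewrite ler_pM2l //; apply: ler_pM.
have sD : s * D <= 4 * c * (256 * F) by apply: ler_pM.
have cD : c * D <= c * (256 * F) by rewrite ler_pM2l.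
have sn : s * m ^+ 2 <= 2304 * c ^+ 3 * m ^+ 3 by apply: ler_pM.
have nss : m ^+ 3 * (s * s) <= m ^+ 3 * (256 * c ^+ 3) by rewrite ler_wpM2l.
have nsss : m ^+ 3 * (s * s * s) <= m ^+ 3 * (64 * c ^+ 3) by rewrite ler_wpM2l.
have ncs : m ^+ 3 * (c * s) <= m ^+ 3 * (64 * c ^+ 3) by rewrite ler_wpM2l.
have ncss : m ^+ 3 * (c * (s * s)) <= m ^+ 3 * (16 * c ^+ 3) by rewrite ler_wpM2l.
have cF : 0 <= c * F by rewrite mulr_ge0 // ltW.
have cn : 0 <= m ^+ 3 * c ^+ 3 by rewrite mulr_ge0 // exprn_ge0 // ltW.
have -> : s * (2 * D + m ^+ 2 * (1 + 16 * m * (s * (1 + s)))) +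
  ((2 * D + m ^+ 2 * (2 * (16 * m * (s * (1 + s))))) * c + m ^+ 3 * c ^+ 3) =
  2 * (s * D) + s * m ^+ 2 + 16 * (m ^+ 3 * (s * s)) + 16 * (m ^+ 3 * (s * s * s))
  + 2 * (c * D) + 32 * (m ^+ 3 * (c * s)) + 32 * (m ^+ 3 * (c * (s * s)))
  + m ^+ 3 * c ^+ 3 by ring.
(* The bounds above add up to 2560 times [c * F] and 9985 times [m ^+ 3 * c ^+ 3], both below
   [100 ^+ 2]. *)
have -> : 100 ^+ 2 * (F * c + m ^+ 3 * c ^+ 3) =
  100 ^+ 2 * (c * F) + 100 ^+ 2 * (m ^+ 3 * c ^+ 3) by ring.
lra.
Qed.

End Rates.

Definition rr_post (t : {ffun 'I_n -> {ffun 'I_n -> bool}}) (b : bool) : R :=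
  let M := noisy_mx eps (flatten_reports t) in
  tri M + (-1) ^+ b * Num.sqrt (noise_sqr M).

(* At parameter 0, Randomized Response outputs a uniform bit. *)
Definition fair_coin : fdist R bool := rr_bit 0 true.

Lemma fair_coinE b : fair_coin b = 2^-1.
Proof.
rewrite /= /bit_pmf /rr_keep expR0; case: eqP => _; by field.
Qed.

Definition triangle_alg : noninteractive_alg R n :=
  rr_alg eps (@owned n) fair_coin rr_post.

(** * Mean, variance and error of the algorithm *)

Section Analysis.
Variable G : sgraph n.
Let mu := edge_law eps G.
Let A := triangle_alg.

Lemma Expect_run (F : {ffun 'I_n * 'I_n -> bool} -> bool -> R) :
  Expect (run_law A G) (fun w => F (flatten_reports w.1) w.2) =
  Expect mu (fun t => (F t false + F t true) / 2).
Proof.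
rewrite Expect_pair -(Expect_flatten _ fair_coin rr_post); apply: eq_Expect => t.
by rewrite /Expect big_bool !fair_coinE /=; field.
Qed.

Lemma Expect_triangle_alg : Expect (run_law A G) (@estimate R n A) = #|triangles G|%:R.
Proof.
rewrite (Expect_run (fun t b => tri (noisy_mx eps t) +
  (-1) ^+ b * Num.sqrt (noise_sqr (noisy_mx eps t)))) -(Expect_tri G eps_gt0).
by apply: eq_Expect => t /=; field.
Qed.

(** The sign is fair and independent of the reports, so the cross term averages out and the squared
    noise remains. *)
Lemma Variance_triangle_alg : Variance (run_law A G) (@estimate R n A) =
  Variance mu (fun t => tri (noisy_mx eps t)) +
  Expect mu (fun t => noise_sqr (noisy_mx eps t)).
Proof.
rewrite /Variance Expect_triangle_alg (Expect_tri G eps_gt0) -ExpectD.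
rewrite (Expect_run (fun t b => (tri (noisy_mx eps t) +
  (-1) ^+ b * Num.sqrt (noise_sqr (noisy_mx eps t)) - #|triangles G|%:R) ^+ 2)).
apply: eq_Expect => t /=.
have := sqr_sqrtr (noise_sqr_ge0 (noisy_mx eps t)).
by move: (Num.sqrt _) => y <-; field.
Qed.

Lemma triangle_alg_lower :
  2^-1 * variance_rate eps G <= Variance (run_law A G) (@estimate R n A).
Proof.
rewrite Variance_triangle_alg; apply: le_trans (lerD (Variance_ge0 _ _) (lexx _)).
rewrite add0r; apply: le_trans (noise_sqr_lower G).
have N0 : 0 <= n%:R ^+ 3 / eps ^+ 6 by rewrite divr_ge0 ?exprn_ge0 // ltW.
rewrite /variance_rate mulrDr lerD //; last by lra.
rewrite mulrCA mulrA ler_wpM2r ?invr_ge0 ?sqr_ge0 // ler_pM2r ?invr_gt0 //.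
by rewrite ler_nat four_cycles_le.
Qed.

Lemma triangle_alg_upper :
  Variance (run_law A G) (@estimate R n A) <= 100 ^+ 2 * variance_rate eps G.
Proof.
rewrite Variance_triangle_alg; apply: le_trans (upper_rate G).
by rewrite lerD ?Variance_tri_upper ?noise_sqr_upper.
Qed.

Lemma error_rate_ge0 : 0 <= error_rate eps G.
Proof.
by rewrite addr_ge0 ?divr_ge0 ?sqrtr_ge0 ?powR_ge0 ?exprn_ge0 // ltW.
Qed.

(** The two sides differ by the nonnegative cross term of the square. *)
Lemma variance_rate_le : variance_rate eps G <= error_rate eps G ^+ 2.
Proof.
have pw : (n%:R `^ (3 / 2) : R) ^+ 2 = n%:R ^+ 3.
  rewrite -powR_mulrn ?powR_ge0 // -powRrM divfK ?pnatr_eq0 //.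
  by rewrite powR_mulrn.
rewrite /error_rate sqrrD !expr_div_n sqr_sqrtr ?ler0n // pw -exprM /variance_rate.
rewrite addrAC lerDl mulrn_wge0 // mulr_ge0 ?divr_ge0 ?sqrtr_ge0 ?powR_ge0 ?exprn_ge0 //.
  by rewrite ltW.
by rewrite ltW.
Qed.

End Analysis.
End Estimator.

Theorem theorem1p2 (R : realType) :
  exists (c1 c2 : R) (K : R -> R), [/\ 0 < c1, 0 < c2 &
    forall (eps : R) (n : nat), 0 < eps ->
    exists A : noninteractive_alg R n,
      [/\ based_on_rr eps A,
          ledp A eps &
          forall G : sgraph n,
            [/\ Expect (run_law A G) (@estimate R n A) = #|triangles G|%:R,
                c1 * variance_rate eps G <= Variance (run_law A G) (@estimate R n A),
                Variance (run_law A G) (@estimate R n A) <= c2 * variance_rate eps G &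
                forall delta : R, 0 < delta -> delta < 1 ->
                  1 - delta <=
                  Pr (run_law A G) (fun w =>
                    `|estimate w - #|triangles G|%:R| <= K delta * error_rate eps G)]]].
Proof.
(* The factor 1/2 comes from comparing [d * (d - 1)] with the squared excess, [100 ^+ 2] from
   [upper_rate], and [K] is chosen so that [delta * K delta ^+ 2 = 100 ^+ 2] in Chebyshev's
   inequality. *)
exists 2^-1, (100 ^+ 2), (fun delta => Num.sqrt (100 ^+ 2 / delta)).
split=> [||eps n eps_gt0]; [by rewrite invr_gt0 | by rewrite exprn_gt0 |].
exists (triangle_alg eps n); split=> [||G].
- by exists (@owned n), bool, (fair_coin R), (@rr_post R eps n).
- exact: rr_alg_ledp.
split=> [|||delta delta0 _].
- exact: Expect_triangle_alg.
- exact: triangle_alg_lower.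
- exact: triangle_alg_upper.
rewrite -(Expect_triangle_alg eps_gt0 G); apply: chebyshev => //.
- exact: sqrtr_ge0.
- exact: error_rate_ge0.
rewrite sqr_sqrtr ?divr_ge0 ?exprn_ge0 ?(ltW delta0) // [delta * _]mulrC divfK ?gt_eqF //.
apply: le_trans (triangle_alg_upper eps_gt0 G) _.
by rewrite ler_wpM2l ?exprn_ge0 ?variance_rate_le.
Qed.
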